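(* Let $\theta^0_1,\theta^0_2,\theta^\infty_1,\theta^\infty_2,\theta^\infty_3\in\mathbb{C}$ with $\theta^0_1+\theta^0_2+\theta^\infty_1+\theta^\infty_2+\theta^\infty_3=0$, $\theta^0_1\ne0$ and $\theta^\infty_1,\theta^\infty_2,\theta^\infty_3$ pairwise distinct. Let $q_1,p_1,q_2,p_2,u,v$ be holomorphic functions of $t$ on a domain of $\mathbb{C}$, with $u,v\neq0$. Put $$a=p_2(p_2-q_2-t)+p_1p_2+\theta^0_1+\theta^\infty_2,\quad b=p_1(p_1-q_1-t)+p_1p_2+\theta^\infty_3,\quad c=p_1(q_2-q_1)+\theta^\infty_3,$$ $$\hat A^{(-2)}=\begin{pmatrix}1\\0\\0\end{pmatrix}(1,1,1),\quad \hat A^{(-1)}=\begin{pmatrix}p_1+p_2-t&q_2&q_1\\-p_2&-p_2&-p_2\\-p_1&-p_1&-p_1\end{pmatrix},\quad \hat A^{(0)}=\begin{pmatrix}-\theta^\infty_1&0&0\\-a&-\theta^\infty_2&0\\-b&-c&-\theta^\infty_3\end{pmatrix},$$ $$R=\begin{pmatrix}1&0&0\\\frac{a}{\theta^\infty_1-\theta^\infty_2}&1&0\\\frac1{\theta^\infty_1-\theta^\infty_3}\left(b+\frac{ac}{\theta^\infty_1-\theta^\infty_2}\right)&\frac{c}{\theta^\infty_2-\theta^\infty_3}&1\end{pmatrix},\qquad G=R\,\mathrm{diag}(1,u,v).$$ Consider the linear systems $$\frac{\partial Y}{\partial x}=AY,\quad A=G^{-1}\left(\frac{\hat A^{(-2)}}{x^3}+\frac{\hat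 A^{(-1)}}{x^2}+\frac{\hat A^{(0)}}{x}\right)G,\qquad \frac{\partial Y}{\partial t}=BY,\quad B=\frac1xG^{-1}\hat A^{(-2)}G .$$ Then the compatibility condition $\partial_tA-\partial_xB+[A,B]=O$ (for all $x$) is equivalent to the Hamiltonian system $\frac{dq_i}{dt}=\frac{\partial H}{\partial p_i}$, $\frac{dp_i}{dt}=-\frac{\partial H}{\partial q_i}$ $(i=1,2)$ with $$H=H_{\mathrm{IV}}\left(\theta^\infty_3,\theta^\infty_1-\theta^\infty_3-1;t;q_1,p_1\right)+H_{\mathrm{IV}}\left(\theta^0_1+\theta^\infty_2,\theta^\infty_1-\theta^\infty_2-\theta^\infty_3-1;t;q_2,p_2\right)+2p_1q_1p_2,$$ together with $$\frac1u\frac{du}{dt}=-p_1-2p_2+q_2+t,\qquad \frac1v\frac{dv}{dt}=q_1-2p_1-2p_2+t .$$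
   Context: $H_{\mathrm{IV}}(\alpha,\beta;t;q,p)=pq(p-q-t)+\beta p+\alpha q$ is the Hamiltonian of the fourth Painlevé equation. The Hamiltonian $H$ is that of the Noumi–Yamada system of type $A_4^{(1)}$; the linear system has an irregular singularity at $x=0$ and a regular singularity at $x=\infty$, of spectral type $((11))((1)),111$. *)

(* Defs.v *)
From HB Require Import structures.
From mathcomp Require Import all_boot all_order all_algebra.
From mathcomp Require Import complex.
From mathcomp Require Import all_classical all_reals all_analysis.

Set Implicit Arguments.
Unset Strict Implicit.
Unset Printing Implicit Defensive.

Import Order.TTheory GRing.Theory Num.Theory.
Import numFieldNormedType.Exports.

Local Open Scope classical_set_scope.
Local Open Scope ring_scope.

(* R[i] seen as an object of numClosedFieldType, so that the standard topology
   and normed structure of numeric fields are inferred on it. *)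
Definition Cplx (R : realType) : numClosedFieldType := R[i]%C.

Definition complex_domain (C : numClosedFieldType) (D : set C) : Prop :=
  [/\ open D, connected D & D !=set0].

(* [derivable f z 1] is the existence of the limit of the difference quotient
   (f (h + z) - f z) / h as h tends to 0 in C, i.e. complex
   differentiability. *)
Definition holomorphic_on (C : numClosedFieldType) (D : set C) (f : C -> C) :
    Prop :=
  forall z, D z -> derivable f z 1.

Definition mx3 (C : numClosedFieldType) (s : seq (seq C)) : 'M[C]_3 :=
  \matrix_(i < 3, j < 3) nth 0 (nth [::] s i) j.

Definition commutator (C : numClosedFieldType) (A B : 'M[C]_3) : 'M[C]_3 :=
  A *m B - B *m A.

(* Compatibility of dY/dx = A Y and dY/dt = B Y for t in D. The point x = 0,
   where A and B have a pole, is excluded. The arguments are [A x t], [B x t]. *)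
Definition compatible (C : numClosedFieldType) (D : set C)
    (A B : C -> C -> 'M[C]_3) : Prop :=
  forall t, D t -> forall x, x != 0 ->
    derive1 (fun s => A x s) t - derive1 (fun y => B y t) x
      + commutator (A x t) (B x t) = 0.

(* theta^0_1, theta^0_2, theta^oo_1, theta^oo_2, theta^oo_3. *)
Record theta (C : numClosedFieldType) := Theta {
  th01 : C; th02 : C; thi1 : C; thi2 : C; thi3 : C }.

Section LaxPair.

Variables (C : numClosedFieldType) (th : theta C).

Definition coef_a (t q1 p1 q2 p2 : C) : C :=
  p2 * (p2 - q2 - t) + p1 * p2 + th01 th + thi2 th.

Definition coef_b (t q1 p1 q2 p2 : C) : C :=
  p1 * (p1 - q1 - t) + p1 * p2 + thi3 th.

Definition coef_c (t q1 p1 q2 p2 : C) : C :=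
  p1 * (q2 - q1) + thi3 th.

Definition Ahat_m2 : 'M[C]_3 :=
  (\col_(i < 3) (i == 0)%:R) *m (\row_(j < 3) 1).

Definition Ahat_m1 (t q1 p1 q2 p2 : C) : 'M[C]_3 :=
  mx3 [:: [:: p1 + p2 - t; q2; q1];
          [:: - p2; - p2; - p2];
          [:: - p1; - p1; - p1]].

Definition Ahat_0 (t q1 p1 q2 p2 : C) : 'M[C]_3 :=
  let a := coef_a t q1 p1 q2 p2 in
  let b := coef_b t q1 p1 q2 p2 in
  let c := coef_c t q1 p1 q2 p2 in
  mx3 [:: [:: - thi1 th; 0; 0];
          [:: - a; - thi2 th; 0];
          [:: - b; - c; - thi3 th]].

Definition Rmx (t q1 p1 q2 p2 : C) : 'M[C]_3 :=
  let a := coef_a t q1 p1 q2 p2 in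
  let b := coef_b t q1 p1 q2 p2 in
  let c := coef_c t q1 p1 q2 p2 in
  mx3 [:: [:: 1; 0; 0];
          [:: a / (thi1 th - thi2 th); 1; 0];
          [:: (thi1 th - thi3 th)^-1 * (b + a * c / (thi1 th - thi2 th));
              c / (thi2 th - thi3 th); 1]].

Definition Gmx (t q1 p1 q2 p2 u v : C) : 'M[C]_3 :=
  Rmx t q1 p1 q2 p2 *m mx3 [:: [:: 1; 0; 0]; [:: 0; u; 0]; [:: 0; 0; v]].

Definition Amx (q1 p1 q2 p2 u v : C -> C) (x t : C) : 'M[C]_3 :=
  let G := Gmx t (q1 t) (p1 t) (q2 t) (p2 t) (u t) (v t) in
  invmx G
  *m (x ^- 3 *: Ahat_m2
      + x ^- 2 *: Ahat_m1 t (q1 t) (p1 t) (q2 t) (p2 t)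
      + x^-1 *: Ahat_0 t (q1 t) (p1 t) (q2 t) (p2 t))
  *m G.

Definition Bmx (q1 p1 q2 p2 u v : C -> C) (x t : C) : 'M[C]_3 :=
  let G := Gmx t (q1 t) (p1 t) (q2 t) (p2 t) (u t) (v t) in
  x^-1 *: (invmx G *m Ahat_m2 *m G).

Definition H_IV (alpha beta t q p : C) : C :=
  p * q * (p - q - t) + beta * p + alpha * q.

(* The variables are the time t and the canonical pairs (q1, p1), (q2, p2). *)
Definition H_NY (t q1 p1 q2 p2 : C) : C :=
  H_IV (thi3 th) (thi1 th - thi3 th - 1) t q1 p1
  + H_IV (th01 th + thi2 th) (thi1 th - thi2 th - thi3 th - 1) t q2 p2
  + 2 * p1 * q1 * p2.

End LaxPair.

Definition hamiltonian_system (C : numClosedFieldType) (D : set C)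
    (H : C -> C -> C -> C -> C -> C) (q1 p1 q2 p2 : C -> C) : Prop :=
  forall t, D t ->
    [/\ derive1 q1 t =
          derive1 (fun y => H t (q1 t) y (q2 t) (p2 t)) (p1 t),
        derive1 p1 t =
          - derive1 (fun y => H t y (p1 t) (q2 t) (p2 t)) (q1 t),
        derive1 q2 t =
          derive1 (fun y => H t (q1 t) (p1 t) (q2 t) y) (p2 t) &
        derive1 p2 t =
          - derive1 (fun y => H t (q1 t) (p1 t) y (p2 t)) (q2 t)].

Definition gauge_equations (C : numClosedFieldType) (D : set C)
    (q1 p1 q2 p2 u v : C -> C) : Prop :=
  forall t, D t ->
    (u t)^-1 * derive1 u t = - p1 t - 2 * p2 t + q2 t + t /\
    (v t)^-1 * derive1 v t = q1 t - 2 * p1 t - 2 * p2 t + t.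

(* Main.v *)
Require Import Defs.
From HB Require Import structures.
From mathcomp Require Import all_boot all_order all_algebra.
From mathcomp Require Import all_classical all_reals all_analysis.
From mathcomp Require Import ring.

Set Implicit Arguments.
Unset Strict Implicit.
Unset Printing Implicit Defensive.

Import Order.TTheory GRing.Theory Num.Theory.
Import numFieldNormedType.Exports.

Local Open Scope classical_set_scope.
Local Open Scope ring_scope.

(** The equivalence holds at each point t of the domain separately. Undo the
gauge transformation G: writing N, A1, A0 for the coefficients of x^-3, x^-2,
x^-1 of the connection before conjugation, and L = (dG/dt) G^-1, the
compatibility condition is conjugate by G to

  x^-3 ([N,L] + [A1,N]) + x^-2 (A1' + [A1,L] + N + [A0,N])
    + x^-1 (A0' + [A0,L]) = 0

([zero_curvature_conj]). The columns of R are eigenvectors of A0 with constant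
eigenvalues, so the last coefficient vanishes identically
([isospectral_flow], [Ahat_0_eigen]) and compatibility means that the first
two do ([compatibleP]).

The matrix L is lower triangular with diagonal (0, u'/u, v'/v)
([triangular_velocity]). The vanishing of the first two coefficients then
expresses v'/v, the entries of L below the diagonal and the derivatives of
q1, p1, q2, p2 through u'/u alone ([pole_equationsP]); for the right value of
u'/u these are the asserted equations. On the other hand A0' + [A0,L] = 0
determines the entries of L below the diagonal from the derivatives of A0 and
the diagonal of L, because the thi_i are distinct ([residue_eq]).

Comparing the two descriptions of L gives both implications
([pole_equations_NY]). From the Hamiltonian and gauge equations they agree.
Conversely, the entries (2,1) and (3,2) give two linear equations k1 z = 0 and
k2 z = 0 for the deviation z of u'/u from its asserted value. Either of k1 and
k2 may vanish at some point, but k1 + k2 = th01 is nonzero, so z = 0. *)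

(** * Derivatives of matrix-valued functions *)

Lemma cvg_mxP (K : numFieldType) (T : Type) (F : set_system T)
    (FF : Filter F) (m n : nat) (f : T -> 'M[K]_(m, n)) (l : 'M[K]_(m, n)) :
  f x @[x --> F] --> l <-> forall i j, f x i j @[x --> F] --> l i j.
Proof.
split=> [fl i j|fl].
  exact: (cvg_comp _ _ fl (@coord_continuous K m n i j l)).
move=> A [P Pl PA].
have : \forall x \near F, forall i j, P i j (f x i j).
  by apply: filter_forall => i; apply: filter_forall => j; exact: fl (Pl i j).
by apply: filterS => x Px; apply: PA.
Qed.

Section MatrixDerivative.
Context {K : numFieldType} {V : normedModType K}.
Implicit Types (a v : V).

Lemma is_deriveP (W : normedModType K) (f : V -> W) a v (df : W) :
  is_derive a v f df <->
  h^-1 *: (f (h *: v + a) - f a) @[h --> 0^'] --> df.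
Proof.
split=> [[fd <-]|fl]; first exact: fd.
apply: DeriveDef; first by apply/cvg_ex; exists df.
exact: cvg_lim fl.
Qed.

Lemma is_derive_mxP (m n : nat) (F : V -> 'M[K]_(m, n)) a v dF :
  is_derive a v F dF <-> forall i j, is_derive a v (fun s => F s i j) (dF i j).
Proof.
rewrite is_deriveP cvg_mxP.
split=> + i j => /(_ i j).
  by move=> H; apply/is_deriveP; move: H; under eq_fun do rewrite !mxE.
by move=> /is_deriveP; under [in X in _ -> X]eq_fun do rewrite !mxE.
Qed.

Lemma is_derive_mulmx (m n p : nat) (F : V -> 'M[K]_(m, n))
    (G : V -> 'M[K]_(n, p)) a v dF dG :
  is_derive a v F dF -> is_derive a v G dG ->
  is_derive a v (fun s => F s *m G s) (dF *m G a + F a *m dG).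
Proof.
move=> /is_derive_mxP dFE /is_derive_mxP dGE; apply/is_derive_mxP => i j.
rewrite (_ : (fun s => _) = \sum_k (fun s => F s i k) * (fun s => G s k j)).
  have dFG k := is_deriveM (dFE i k) (dGE k j).
  apply: (is_derive_eq (is_derive_sum dFG)).
  rewrite !mxE -big_split /=; apply: eq_bigr => k _.
  by rewrite addrC [dF i k * _]mulrC.
by apply/funext => s; rewrite fct_sumE mxE.
Qed.

Lemma derivable_prod (I : Type) (r : seq I) (f : I -> V -> K) a v :
  (forall i, derivable (f i) a v) ->
  derivable (fun s => \prod_(i <- r) f i s) a v.
Proof.
move=> df; elim: r => [|i r IHr].
  by under eq_fun do rewrite big_nil; exact: derivable_cst.
by under eq_fun do rewrite big_cons; exact: derivableM.
Qed.

Lemma derivable_det (n : nat) (F : V -> 'M[K]_n) a v :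
  (forall i j, derivable (fun s => F s i j) a v) ->
  derivable (fun s => \det (F s)) a v.
Proof.
move=> dF; rewrite /determinant; elim: (index_enum _) => [|s r IHr].
  by under eq_fun do rewrite big_nil; exact: derivable_cst.
under eq_fun do rewrite big_cons.
apply: derivableD => //; apply: derivableM; first exact: derivable_cst.
exact: derivable_prod.
Qed.

End MatrixDerivative.

(** By Cramer's rule the inverse is differentiable as long as the determinant
does not vanish, which is an open condition; its derivative then comes from
differentiating F F^-1 = 1. *)
Lemma is_derive_invmx (K : numFieldType) (n : nat) (F : K -> 'M[K]_n) (a : K)
    dF :
  is_derive a 1 F dF -> F a \in unitmx ->
  is_derive a 1 (fun s => invmx (F s)) (- (invmx (F a) *m dF *m invmx (F a))).
Proof.
move=> FdF Fa.
have dFE i j : derivable (fun s => F s i j) a 1.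
  by have /is_derive_mxP/(_ i j)[] := FdF.
have ddet := derivable_det dFE.
have det_neq0 : \det (F a) != 0 by rewrite -unitfE -unitmxE.
have nearU : \forall s \near a, F s \in unitmx.
  have /derivable1_diffP/differentiable_continuous cdet := ddet.
  apply: filterS (cvgr_neq0 _ cdet det_neq0) => s.
  by rewrite unitmxE unitfE.
have dinv : derivable (fun s => invmx (F s)) a 1.
  have dadj i j : derivable (fun s => (\det (F s))^-1 * (\adj (F s)) i j) a 1.
    apply: derivableM; first exact: derivableV.
    under eq_fun do rewrite mxE.
    apply: derivableM; first exact: derivable_cst.
    apply: derivable_det => k l.
    by under eq_fun do rewrite !mxE; exact: dFE.
  pose dA :=
    \matrix_(i, j) 'D_1 (fun s => (\det (F s))^-1 * (\adj (F s)) i j) a.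
  have dcramer : is_derive a 1 (fun s => (\det (F s))^-1 *: \adj (F s)) dA.
    apply/is_derive_mxP => i j; rewrite mxE; under eq_fun do rewrite mxE.
    exact: derivableP.
  apply: near_eq_derivable (@ex_derive _ _ _ _ _ _ _ dcramer).
  by apply: filterS nearU => s Fs; rewrite /invmx Fs.
have Hinv := derivableP dinv.
set dI := 'D_1 _ a in Hinv *.
have := is_derive_mulmx FdF Hinv.
have H1 : is_derive a (1 : K) (fun s => F s *m invmx (F s)) 0.
  apply: near_eq_is_derive (is_derive_cst 1%:M _ _).
  by apply: filterS nearU => s Fs; rewrite mulmxV.
case=> _; rewrite (@derive_val _ _ _ _ _ _ _ H1) => /esym H0.
apply: is_derive_eq.
apply: (can_inj (mulKmx Fa)).
rewrite mulmxN !mulmxA mulmxV// mul1mx.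
by apply/eqP; rewrite -addr_eq0 addrC H0.
Qed.

(** * The zero curvature equation after undoing the gauge *)

Section ZeroCurvature.
Context {C : numClosedFieldType}.
Implicit Types (G X : C -> 'M[C]_3) (t x : C).

Lemma commutatorDl (A B M : 'M[C]_3) :
  commutator (A + B) M = commutator A M + commutator B M.
Proof. by rewrite /commutator mulmxDl mulmxDr opprD addrACA. Qed.

Lemma commutatorZ (k l : C) (A B : 'M[C]_3) :
  commutator (k *: A) (l *: B) = (k * l) *: commutator A B.
Proof.
by rewrite /commutator -!scalemxAl -!scalemxAr !scalerA scalerBr (mulrC l).
Qed.

Lemma commutatorxx (A : 'M[C]_3) : commutator A A = 0.
Proof. exact: subrr. Qed.

Lemma commutator_conj (g A B : 'M[C]_3) : g \in unitmx ->
  commutator (invmx g *m A *m g) (invmx g *m B *m g) =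
  invmx g *m commutator A B *m g.
Proof.
move=> gU; rewrite /commutator mulmxBr mulmxBl.
by rewrite !mulmxA !(mulmxK gU).
Qed.

Lemma is_derive_conj G X t dG dX :
  is_derive t 1 G dG -> is_derive t 1 X dX -> G t \in unitmx ->
  is_derive t 1 (fun s => invmx (G s) *m X s *m G s)
    (invmx (G t) *m (dX + commutator (X t) (dG *m invmx (G t))) *m G t).
Proof.
move=> GdG XdX Gt.
have dinv := is_derive_invmx GdG Gt.
apply: (is_derive_eq (is_derive_mulmx (is_derive_mulmx dinv XdX) GdG)).
rewrite /commutator mulmxDr mulmxBr !mulmxDl !mulNmx !mulmxA.
by rewrite !(mulmxKV Gt) -addrA addrC -addrA.
Qed.

(** A matrix diagonalised by G(t) with constant eigenvalues obeys a Lax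
equation: differentiate X G = G T and eliminate T = G^-1 X G. *)
Lemma isospectral_flow G X t dG dX (T : 'M[C]_3) :
  is_derive t 1 G dG -> is_derive t 1 X dX -> G t \in unitmx ->
  (forall s, X s *m G s = G s *m T) ->
  dX + commutator (X t) (dG *m invmx (G t)) = 0.
Proof.
move=> GdG XdX Gt XG.
have [_ dXG] := is_derive_mulmx XdX GdG.
have [_ dGT] := is_derive_mulmx GdG (is_derive_cst T t 1).
have E : dX *m G t + X t *m dG = dG *m T.
  by rewrite -dXG (eq_fun XG) dGT mulmx0 addr0.
apply: (can_inj (mulmxK Gt)).
rewrite mul0mx mulmxDl /commutator mulmxBl !mulmxA (mulmxKV Gt).
by rewrite addrA E -!mulmxA XG (mulKmx Gt) subrr.
Qed.

Lemma laurent_eq0 (X3 X2 : 'M[C]_3) :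
  (forall x : C, x != 0 -> x ^- 3 *: X3 + x ^- 2 *: X2 = 0) <->
  X3 = 0 /\ X2 = 0.
Proof.
split=> [H|[-> ->] x _]; last by rewrite !scaler0 addr0.
(* One exponent is odd and the other even, so x = 1 and x = -1 suffice. *)
have Ep := H 1 (oner_neq0 _).
have En := H (- 1) ltac:(by rewrite oppr_eq0 oner_neq0).
rewrite !expr1n invr1 !scale1r in Ep.
rewrite [(- 1) ^+ 3]exprS sqrrN expr1n invr1 mulr1 invrN invr1 in En.
rewrite scaleN1r scale1r in En.
have E2 : X2 = X3 by apply/eqP; rewrite -subr_eq0 addrC En.
rewrite E2 -mulr2n in Ep.
suff: X3 = 0 by rewrite E2 => ->.
by apply/eqP; move/eqP: Ep; rewrite -scaler_nat scaler_eq0 pnatr_eq0.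
Qed.

Lemma is_derive_scale_inv (n : nat) (M : 'M[C]_n) x : x != 0 ->
  is_derive x 1 (fun y => y^-1 *: M) (- (x ^- 2 *: M)).
Proof.
move=> x0; apply/is_derive_mxP => i j.
under eq_fun do rewrite mxE.
have dV : is_derive x (1 : C) (fun y : C => y^-1) (- x ^- 2).
  apply: DeriveDef; first exact: derivableV.
  by rewrite deriveV// derive_id [_%:A]mulr1.
have dc : is_derive x (1 : C) (fun _ : C => M i j) 0 by exact: is_derive_cst.
apply: (is_derive_eq (is_deriveM dV dc)).
by rewrite !mxE scaler0 add0r scalerN; congr (- _); exact: mulrC.
Qed.

(** There is no x^-4 term because the leading coefficient of A commutes with
B, to which it is proportional. *)
Lemma zero_curvature_conj G (X3 X2 X1 : C -> 'M[C]_3) t dG dX3 dX2 dX1 x :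
  is_derive t 1 G dG -> G t \in unitmx ->
  is_derive t 1 X3 dX3 -> is_derive t 1 X2 dX2 -> is_derive t 1 X1 dX1 ->
  x != 0 ->
  let L := dG *m invmx (G t) in
  let A s := invmx (G s) *m (x ^- 3 *: X3 s + x ^- 2 *: X2 s + x^-1 *: X1 s)
               *m G s in
  let B y := y^-1 *: (invmx (G t) *m X3 t *m G t) in
  derive1 A t - derive1 B x + commutator (A t) (B x) =
  invmx (G t) *m
    (x ^- 3 *: (dX3 + commutator (X3 t) L + commutator (X2 t) (X3 t))
     + x ^- 2 *: (dX2 + commutator (X2 t) L + X3 t + commutator (X1 t) (X3 t))
     + x^-1 *: (dX1 + commutator (X1 t) L)) *m G t.
Proof.
move=> GdG Gt d3 d2 d1 x0 L A B.
have dX : is_derive t 1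
    (fun s => x ^- 3 *: X3 s + x ^- 2 *: X2 s + x^-1 *: X1 s)
    (x ^- 3 *: dX3 + x ^- 2 *: dX2 + x^-1 *: dX1).
  by apply: is_deriveD.
have [_ dA] := is_derive_conj GdG dX Gt.
have [_ dB] := is_derive_scale_inv (invmx (G t) *m X3 t *m G t) x0.
rewrite !derive1E dA dB opprK.
rewrite (_ : B x = invmx (G t) *m (x^-1 *: X3 t) *m G t); last first.
  by rewrite -scalemxAr -scalemxAl.
rewrite commutator_conj// scalemxAl scalemxAr -!mulmxDl -!mulmxDr -/L.
congr (_ *m _ *m _).
rewrite !commutatorDl !commutatorZ commutatorxx scaler0 add0r.
rewrite -{1 2 3}[L]scale1r !commutatorZ !mulr1.
rewrite -invfM -exprSr.
rewrite -expr2 -!exprVn.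
move: (commutator (X3 t) L) (commutator (X2 t) L) (commutator (X1 t) L)
  (commutator (X2 t) (X3 t)) (commutator (X1 t) (X3 t)) => c3 c2 c1 c23 c13.
by apply/matrixP => i j; rewrite !mxE; ring.
Qed.

Lemma compatibleP G (X3 X2 X1 : C -> 'M[C]_3) t dG dX3 dX2 dX1 :
  is_derive t 1 G dG -> G t \in unitmx ->
  is_derive t 1 X3 dX3 -> is_derive t 1 X2 dX2 -> is_derive t 1 X1 dX1 ->
  let L := dG *m invmx (G t) in
  dX1 + commutator (X1 t) L = 0 ->
  (forall x, x != 0 ->
  derive1 (fun s => invmx (G s)
                    *m (x ^- 3 *: X3 s + x ^- 2 *: X2 s + x^-1 *: X1 s)
                    *m G s) t
  - derive1 (fun y => y^-1 *: (invmx (G t) *m X3 t *m G t)) x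
  + commutator
     (invmx (G t) *m (x ^- 3 *: X3 t + x ^- 2 *: X2 t + x^-1 *: X1 t) *m G t)
     (x^-1 *: (invmx (G t) *m X3 t *m G t)) = 0) <->
  dX3 + commutator (X3 t) L + commutator (X2 t) (X3 t) = 0 /\
  dX2 + commutator (X2 t) L + X3 t + commutator (X1 t) (X3 t) = 0.
Proof.
move=> GdG Gt d3 d2 d1 L E1; rewrite -laurent_eq0.
split=> H x x0; have := H x x0;
  rewrite (zero_curvature_conj GdG Gt d3 d2 d1 x0) -/L E1 scaler0 addr0.
  move/(congr1 (fun M => G t *m M *m invmx (G t))).
  by rewrite mulmx0 mul0mx !mulmxA (mulmxV Gt) mul1mx (mulmxK Gt).
by move=> ->; rewrite mulmx0 mul0mx.
Qed.

End ZeroCurvature.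

(** * Explicit 3 x 3 matrices *)

Section ExplicitMatrices.
Context {C : numClosedFieldType}.

Lemma mx3_mul (a b c d e f g h i a' b' c' d' e' f' g' h' i' : C) :
  mx3 [:: [:: a; b; c]; [:: d; e; f]; [:: g; h; i]]
  *m mx3 [:: [:: a'; b'; c']; [:: d'; e'; f']; [:: g'; h'; i']] =
  mx3 [:: [:: a * a' + b * d' + c * g'; a * b' + b * e' + c * h';
              a * c' + b * f' + c * i'];
          [:: d * a' + e * d' + f * g'; d * b' + e * e' + f * h';
              d * c' + e * f' + f * i'];
          [:: g * a' + h * d' + i * g'; g * b' + h * e' + i * h';
              g * c' + h * f' + i * i']].
Proof.
apply/matrixP => -[[|[|[|//]]] ?] [[|[|[|//]]] ?];
  by rewrite !mxE !big_ord_recl big_ord0 !mxE /= addr0 addrA.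
Qed.

Lemma mx3_add (a b c d e f g h i a' b' c' d' e' f' g' h' i' : C) :
  mx3 [:: [:: a; b; c]; [:: d; e; f]; [:: g; h; i]]
  + mx3 [:: [:: a'; b'; c']; [:: d'; e'; f']; [:: g'; h'; i']] =
  mx3 [:: [:: a + a'; b + b'; c + c']; [:: d + d'; e + e'; f + f'];
          [:: g + g'; h + h'; i + i']].
Proof. by apply/matrixP => -[[|[|[|//]]] ?] [[|[|[|//]]] ?]; rewrite !mxE. Qed.

Lemma mx3_opp (a b c d e f g h i : C) :
  - mx3 [:: [:: a; b; c]; [:: d; e; f]; [:: g; h; i]] =
  mx3 [:: [:: - a; - b; - c]; [:: - d; - e; - f]; [:: - g; - h; - i]].
Proof. by apply/matrixP => -[[|[|[|//]]] ?] [[|[|[|//]]] ?]; rewrite !mxE. Qed.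

Lemma mx3_0 : 0 = mx3 [:: [:: 0; 0; 0]; [:: 0; 0; 0]; [:: 0; 0; 0]] :> 'M[C]_3.
Proof. by apply/matrixP => -[[|[|[|//]]] ?] [[|[|[|//]]] ?]; rewrite !mxE. Qed.

Lemma mx3_inj (a b c d e f g h i a' b' c' d' e' f' g' h' i' : C) :
  mx3 [:: [:: a; b; c]; [:: d; e; f]; [:: g; h; i]] =
  mx3 [:: [:: a'; b'; c']; [:: d'; e'; f']; [:: g'; h'; i']] ->
  [/\ a = a', b = b' & c = c'] /\ [/\ d = d', e = e' & f = f'] /\
  [/\ g = g', h = h' & i = i'].
Proof.
pose o k (lt_k : (k < 3)%N) : 'I_3 := Ordinal lt_k.
move=> /matrixP E.
have E' k l lt_k lt_l := E (@o k lt_k) (@o l lt_l).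
do !split; [move: (E' 0%N 0%N isT isT) | move: (E' 0%N 1%N isT isT)
 | move: (E' 0%N 2 isT isT) | move: (E' 1%N 0%N isT isT)
 | move: (E' 1%N 1%N isT isT) | move: (E' 1%N 2 isT isT)
 | move: (E' 2 0%N isT isT) | move: (E' 2 1%N isT isT)
 | move: (E' 2 2 isT isT) ]; by rewrite !mxE.
Qed.

Lemma mx3_eta (M : 'M[C]_3) : exists a b c d e f g h i : C,
  M = mx3 [:: [:: a; b; c]; [:: d; e; f]; [:: g; h; i]].
Proof.
pose o k (lt_k : (k < 3)%N) : 'I_3 := Ordinal lt_k.
exists (M (@o 0%N isT) (@o 0%N isT)), (M (@o 0%N isT) (@o 1%N isT)),
  (M (@o 0%N isT) (@o 2 isT)), (M (@o 1%N isT) (@o 0%N isT)),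
  (M (@o 1%N isT) (@o 1%N isT)), (M (@o 1%N isT) (@o 2 isT)),
  (M (@o 2 isT) (@o 0%N isT)), (M (@o 2 isT) (@o 1%N isT)),
  (M (@o 2 isT) (@o 2 isT)).
apply/matrixP => -[[|[|[|//]]] ?] [[|[|[|//]]] ?]; rewrite !mxE /=;
  congr (M _ _); exact: val_inj.
Qed.

Lemma is_derive_mx3 (a b c d e f g h i : C -> C)
    (t da db dc dd de df dg dh di : C) :
  is_derive t 1 a da -> is_derive t 1 b db -> is_derive t 1 c dc ->
  is_derive t 1 d dd -> is_derive t 1 e de -> is_derive t 1 f df ->
  is_derive t 1 g dg -> is_derive t 1 h dh -> is_derive t 1 i di ->
  is_derive t 1
    (fun s =>
       mx3 [:: [:: a s; b s; c s]; [:: d s; e s; f s]; [:: g s; h s; i s]])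
    (mx3 [:: [:: da; db; dc]; [:: dd; de; df]; [:: dg; dh; di]]).
Proof.
move=> *; apply/is_derive_mxP => -[[|[|[|//]]] ?] [[|[|[|//]]] ?];
  by rewrite mxE; under eq_fun do rewrite mxE.
Qed.

Lemma Ahat_m2E :
  Ahat_m2 C = mx3 [:: [:: 1; 1; 1]; [:: 0; 0; 0]; [:: 0; 0; 0]].
Proof.
by apply/matrixP => -[[|[|[|//]]] ?] [[|[|[|//]]] ?];
  rewrite !mxE big_ord_recl big_ord0 !mxE /= ?mul1r ?mul0r addr0.
Qed.

(** Applied to G and dG/dt this gives the shape of L = (dG/dt) G^-1: the
logarithmic derivatives of u and v are its diagonal entries. *)
Lemma triangular_velocity (g21 g31 g32 u v dg21 du dg31 dg32 dv : C)
    (L : 'M[C]_3) :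
  u != 0 -> v != 0 ->
  L *m mx3 [:: [:: 1; 0; 0]; [:: g21; u; 0]; [:: g31; g32; v]] =
    mx3 [:: [:: 0; 0; 0]; [:: dg21; du; 0]; [:: dg31; dg32; dv]] ->
  exists l21 l31 l32,
    L = mx3 [:: [:: 0; 0; 0]; [:: l21; u^-1 * du; 0];
                [:: l31; l32; v^-1 * dv]].
Proof.
move=> u0 v0.
have [a [b [c [d [e [f [g [h [i ->]]]]]]]]] := mx3_eta L.
rewrite mx3_mul => /mx3_inj[[E11 E12 E13] [[_ E22 E23] [_ _ E33]]].
have kill (x y : C) : y != 0 -> x * y = 0 -> x = 0.
  by move=> y0 /eqP; rewrite mulf_eq0 (negPf y0) orbF => /eqP.
rewrite !(mulr0, add0r) in E12 E13 E22 E23 E33.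
have c0 : c = 0 := kill _ _ v0 E13.
have f0 : f = 0 := kill _ _ v0 E23.
rewrite c0 mul0r addr0 in E12; have b0 : b = 0 := kill _ _ u0 E12.
rewrite b0 c0 !mul0r !addr0 mulr1 in E11.
rewrite f0 mul0r addr0 in E22.
exists d, g, h; rewrite E11 b0 c0 f0 -E22 -E33.
by rewrite ![_^-1 * _]mulrC (mulfK u0) (mulfK v0).
Qed.

End ExplicitMatrices.

(** * The algebraic core at a fixed time *)

Lemma eq_of_sub (V : zmodType) (x y z : V) : z = 0 -> x - y = z -> x = y.
Proof. by move=> -> /eqP; rewrite subr_eq0 => /eqP. Qed.

Section Pointwise.
Context {C : numClosedFieldType}.
Variable th : theta C.
Variables (t q1 p1 q2 p2 dq1 dp1 dq2 dp2 : C).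
Variables (l21 l22 l31 l32 l33 : C).

Let a := coef_a th t q1 p1 q2 p2.
Let b := coef_b th t q1 p1 q2 p2.
Let c := coef_c th t q1 p1 q2 p2.

Definition dcoef_a : C :=
  dp2 * (p2 - q2 - t) + p2 * (dp2 - dq2 - 1) + dp1 * p2 + p1 * dp2.
Definition dcoef_b : C :=
  dp1 * (p1 - q1 - t) + p1 * (dp1 - dq1 - 1) + dp1 * p2 + p1 * dp2.
Definition dcoef_c : C := dp1 * (q2 - q1) + p1 * (dq2 - dq1).

Definition dAhat_m1 : 'M[C]_3 :=
  mx3 [:: [:: dp1 + dp2 - 1; dq2; dq1];
          [:: - dp2; - dp2; - dp2];
          [:: - dp1; - dp1; - dp1]].

Definition dAhat_0 : 'M[C]_3 :=
  mx3 [:: [:: 0; 0; 0];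
          [:: - dcoef_a; 0; 0];
          [:: - dcoef_b; - dcoef_c; 0]].

Definition NY_equations : Prop :=
  [/\ dq1 = 2 * p1 * q1 - q1 ^+ 2 - t * q1 + (thi1 th - thi3 th - 1)
            + 2 * q1 * p2,
      dp1 = - (p1 ^+ 2 - 2 * p1 * q1 - t * p1 + thi3 th + 2 * p1 * p2),
      dq2 = 2 * p2 * q2 - q2 ^+ 2 - t * q2
            + (thi1 th - thi2 th - thi3 th - 1) + 2 * p1 * q1 &
      dp2 = - (p2 ^+ 2 - 2 * p2 * q2 - t * p2 + (th01 th + thi2 th))].

Let L : 'M[C]_3 := mx3 [:: [:: 0; 0; 0]; [:: l21; l22; 0]; [:: l31; l32; l33]].

Lemma residue_eq :
  dAhat_0 + commutator (Ahat_0 th t q1 p1 q2 p2) L = 0 ->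
  [/\ (thi1 th - thi2 th) * l21 = dcoef_a - a * l22,
      (thi2 th - thi3 th) * l32 = dcoef_c + c * (l22 - l33) &
      (thi1 th - thi3 th) * l31 = dcoef_b + c * l21 - a * l32 - b * l33].
Proof.
rewrite /commutator /L /Ahat_0 /dAhat_0 -/a -/b -/c.
rewrite !mx3_mul mx3_opp !mx3_add mx3_0.
by move=> /mx3_inj[_ [[E21 _ _] [E31 E32 _]]]; split;
  [apply: (eq_of_sub E21)|apply: (eq_of_sub E32)|apply: (eq_of_sub E31)]; ring.
Qed.

(** The coefficients of x^-3 and x^-2 in the zero curvature equation. *)
Definition pole_equations : Prop :=
  commutator (Ahat_m2 C) L
    + commutator (Ahat_m1 t q1 p1 q2 p2) (Ahat_m2 C) = 0 /\
  dAhat_m1 + commutator (Ahat_m1 t q1 p1 q2 p2) L + Ahat_m2 C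
    + commutator (Ahat_0 th t q1 p1 q2 p2) (Ahat_m2 C) = 0.

(** The x^-3 coefficient says that L - Ahat_m1 commutes with the rank one
matrix Ahat_m2, i.e. that the column (1,0,0) and the row (1,1,1) are
eigenvectors of it with the same eigenvalue; this yields the first group of
equations. Modulo them, the first row of the x^-2 coefficient gives dq1 and
dq2, and its other rows are constant and give dp1 and dp2; the entry (1,1) is
then a consequence. *)
Lemma pole_equationsP : pole_equations <->
  [/\ l21 = - p2, l31 = - p1,
      l32 = q2 - 2 * (p1 + p2) + t - l22 &
      l33 = q1 - 2 * p1 - 2 * p2 + t] /\
  [/\ dq1 = - q1 * l33 + thi1 th - thi3 th - 1,
      dp1 = p1 * (2 * p1 + 2 * p2 - t) + p2 * l32 + p1 * l33 - b,
      dq2 = - q2 * l22 - q1 * l32 + thi1 th - thi2 th - c - 1 &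
      dp2 = p2 * (2 * p1 + 2 * p2 - t) + p2 * l22 - a].
Proof.
rewrite /pole_equations /commutator Ahat_m2E /L /Ahat_m1 /Ahat_0 /dAhat_m1.
rewrite -/a -/b -/c !mx3_mul !mx3_opp !mx3_add mx3_0.
split=> [[/mx3_inj[[_ E12 E13] [[E21 _ _] [E31 _ _]]]
          /mx3_inj[[_ F12 F13] [[F21 _ _] [F31 _ _]]]]|].
  have H21 : l21 = - p2 by apply/esym/(eq_of_sub E21); ring.
  have H31 : l31 = - p1 by apply/esym/(eq_of_sub E31); ring.
  split; split=> //.
  - by apply: (eq_of_sub E12); ring.
  - by apply: (eq_of_sub E13); ring.
  - by apply: (eq_of_sub F13); rewrite ?H21 ?H31; ring.
  - by apply/esym/(eq_of_sub F31); rewrite ?H21 ?H31; ring.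
  - by apply: (eq_of_sub F12); rewrite ?H21 ?H31; ring.
  - by apply/esym/(eq_of_sub F21); rewrite ?H21 ?H31; ring.
move=> [[-> -> -> ->] [-> -> -> ->]].
rewrite /a /b /c /coef_a /coef_b /coef_c.
split; congr (mx3 [:: [:: _; _; _]; [:: _; _; _]; [:: _; _; _]]); ring.
Qed.

Hypotheses (h01 : th01 th != 0) (h12 : thi1 th != thi2 th)
  (h13 : thi1 th != thi3 th) (h23 : thi2 th != thi3 th).
Hypothesis residue :
  dAhat_0 + commutator (Ahat_0 th t q1 p1 q2 p2) L = 0.

(** The entries of L below the diagonal are known from [pole_equationsP] and
from [residue_eq]; comparing the two values of l21 and of l32 determines
l22. *)
Lemma pole_equations_NY : pole_equations <->
  NY_equations /\ l22 = - p1 - 2 * p2 + q2 + t /\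
  l33 = q1 - 2 * p1 - 2 * p2 + t.
Proof.
have [R21 R32 R31] := residue_eq residue.
rewrite pole_equationsP; split.
  move=> [[H21 H31 H32 H33] [Hq1 Hp1 Hq2 Hp2]].
  pose z := l22 - (- p1 - 2 * p2 + q2 + t).
  have z1 : (th01 th + thi2 th + p2 * (q1 - q2)) * z = 0.
    have /esym -> : (thi1 th - thi2 th) * l21 - (dcoef_a - a * l22) = 0.
      by rewrite R21 subrr.
    rewrite /dcoef_a Hp1 Hp2 Hq2 H32 H33 H21 /z /a /b /c.
    by rewrite /coef_a /coef_b /coef_c; ring.
  have z2 : (- thi2 th + p2 * (q2 - q1)) * z = 0.
    have /esym -> :
        (thi2 th - thi3 th) * l32 - (dcoef_c + c * (l22 - l33)) = 0.
      by rewrite R32 subrr.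
    rewrite /dcoef_c Hp1 Hq2 Hq1 H32 H33 /z /a /b /c.
    by rewrite /coef_a /coef_b /coef_c; ring.
  have z0 : z = 0.
    have : th01 th * z = 0 by rewrite -[RHS]addr0 -{1}z1 -z2; ring.
    by move/eqP; rewrite mulf_eq0 (negPf h01) => /eqP.
  have H22 : l22 = - p1 - 2 * p2 + q2 + t.
    by apply/eqP; rewrite -subr_eq0 -/z z0.
  rewrite /NY_equations Hp1 Hp2 Hq2 Hq1 H32 H33 H22 /a /b /c.
  by rewrite /coef_a /coef_b /coef_c; do !split; ring.
move=> [[Hq1 Hp1 Hq2 Hp2] [H22 H33]].
have cancel (k l x y : C) : k != l -> (k - l) * x = (k - l) * y -> x = y.
  by rewrite -subr_eq0 => /mulfI; apply.
have H21 : l21 = - p2.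
  apply: (cancel _ _ _ _ h12); rewrite R21 /dcoef_a Hp1 Hp2 Hq2 H22.
  by rewrite /a /coef_a; ring.
have H32 : l32 = - p1.
  apply: (cancel _ _ _ _ h23); rewrite R32 /dcoef_c Hp1 Hq2 Hq1 H22 H33.
  by rewrite /c /coef_c; ring.
have H31 : l31 = - p1.
  apply: (cancel _ _ _ _ h13).
  rewrite R31 /dcoef_b Hp1 Hp2 Hq1 H32 H33 H21 /a /b /c.
  by rewrite /coef_a /coef_b /coef_c; ring.
rewrite Hp1 Hp2 Hq2 Hq1 H21 H31 H32 H22 H33 /a /b /c.
by rewrite /coef_a /coef_b /coef_c; do !split; ring.
Qed.

End Pointwise.

(** * The gauge matrix *)

Section GaugeMatrix.
Context {C : numClosedFieldType}.
Variables (th : theta C) (t q1 p1 q2 p2 u v : C).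

Lemma Gmx_explicit :
  Gmx th t q1 p1 q2 p2 u v =
  mx3 [:: [:: 1; 0; 0];
          [:: coef_a th t q1 p1 q2 p2 / (thi1 th - thi2 th); u; 0];
          [:: (thi1 th - thi3 th)^-1
                * (coef_b th t q1 p1 q2 p2
                   + coef_a th t q1 p1 q2 p2 * coef_c th t q1 p1 q2 p2
                     / (thi1 th - thi2 th));
              coef_c th t q1 p1 q2 p2 / (thi2 th - thi3 th) * u; v]].
Proof.
rewrite /Gmx /Rmx mx3_mul.
by rewrite !(mulr0, mul0r, mulr1, mul1r, addr0, add0r).
Qed.

Lemma Gmx_unit : u != 0 -> v != 0 -> Gmx th t q1 p1 q2 p2 u v \in unitmx.
Proof.
move=> u0 v0; rewrite Gmx_explicit unitmxE det_trig.
  by rewrite !big_ord_recl big_ord0 !mxE /= !unitrM !unitfE oner_neq0 u0 v0.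
by apply/is_trig_mxP => -[[|[|[|//]]] ?] [[|[|[|//]]] ?]; rewrite ?mxE.
Qed.

Lemma Ahat_0_eigen :
  thi1 th != thi2 th -> thi1 th != thi3 th -> thi2 th != thi3 th ->
  Ahat_0 th t q1 p1 q2 p2 *m Gmx th t q1 p1 q2 p2 u v =
  Gmx th t q1 p1 q2 p2 u v *m
  mx3 [:: [:: - thi1 th; 0; 0]; [:: 0; - thi2 th; 0]; [:: 0; 0; - thi3 th]].
Proof.
rewrite -subr_eq0 => h12; rewrite -subr_eq0 => h13; rewrite -subr_eq0 => h23.
rewrite Gmx_explicit /Ahat_0 !mx3_mul.
by congr (mx3 [:: [:: _; _; _]; [:: _; _; _]; [:: _; _; _]]); field;
  do ?[apply/andP; split].
Qed.

End GaugeMatrix.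

(** * Time derivatives of the coefficients and of the Hamiltonian *)

Section ScalarRules.
Context {K : numFieldType} {t : K}.
Implicit Types (f g : K -> K).

Lemma is_derive_add f g df dg : is_derive t 1 f df -> is_derive t 1 g dg ->
  is_derive t 1 (fun s => f s + g s) (df + dg).
Proof. exact: is_deriveD. Qed.

Lemma is_derive_sub f g df dg : is_derive t 1 f df -> is_derive t 1 g dg ->
  is_derive t 1 (fun s => f s - g s) (df - dg).
Proof. exact: is_deriveB. Qed.

Lemma is_derive_mul f g df dg : is_derive t 1 f df -> is_derive t 1 g dg ->
  is_derive t 1 (fun s => f s * g s) (f t * dg + g t * df).
Proof. exact: is_deriveM. Qed.

Lemma is_derive_derive1 f : derivable f t 1 -> is_derive t 1 f (derive1 f t).
Proof. by move=> df; rewrite derive1E; exact: derivableP. Qed.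

Lemma derive1_quadratic (k l m : K) :
  derive1 (fun z => k * z ^+ 2 + l * z + m) t = 2 * k * t + l.
Proof.
have dk := @is_derive_cst _ _ K^o k t 1.
have dl := @is_derive_cst _ _ K^o l t 1.
have dm := @is_derive_cst _ _ K^o m t 1.
have di := @is_derive_id _ K^o t 1.
have d := is_derive_add (is_derive_add (is_derive_mul dk (is_derive_mul di di))
  (is_derive_mul dl di)) dm.
rewrite derive1E (@derive_val _ _ _ _ _ _ _ d) /=.
by ring.
Qed.

End ScalarRules.

(** The Hamiltonian is quadratic in each canonical variable separately. *)
Lemma hamiltonian_NY (C : numClosedFieldType) (th : theta C)
    (q1 p1 q2 p2 : C -> C) t :
  [/\ derive1 q1 t =
        derive1 (fun y => H_NY th t (q1 t) y (q2 t) (p2 t)) (p1 t),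
      derive1 p1 t =
        - derive1 (fun y => H_NY th t y (p1 t) (q2 t) (p2 t)) (q1 t),
      derive1 q2 t =
        derive1 (fun y => H_NY th t (q1 t) (p1 t) (q2 t) y) (p2 t) &
      derive1 p2 t =
        - derive1 (fun y => H_NY th t (q1 t) (p1 t) y (p2 t)) (q2 t)] <->
  NY_equations th t (q1 t) (p1 t) (q2 t) (p2 t)
    (derive1 q1 t) (derive1 p1 t) (derive1 q2 t) (derive1 p2 t).
Proof.
set x1 := q1 t; set y1 := p1 t; set x2 := q2 t; set y2 := p2 t.
have quad (f : C -> C) k l m y :
    (forall z, f z = k * z ^+ 2 + l * z + m) -> derive1 f y = 2 * k * y + l.
  by move=> fE; rewrite (funext fE) derive1_quadratic.
have -> : derive1 (fun y => H_NY th t x1 y x2 y2) y1 =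
   2 * y1 * x1 - x1 ^+ 2 - t * x1 + (thi1 th - thi3 th - 1) + 2 * x1 * y2.
  rewrite (quad _ x1
    (- x1 ^+ 2 - t * x1 + (thi1 th - thi3 th - 1) + 2 * x1 * y2)
    (H_NY th t x1 0 x2 y2)); first by ring.
  by move=> z; rewrite /H_NY /H_IV; ring.
have -> : derive1 (fun y => H_NY th t y y1 x2 y2) x1 =
   y1 ^+ 2 - 2 * y1 * x1 - t * y1 + thi3 th + 2 * y1 * y2.
  rewrite (quad _ (- y1) (y1 ^+ 2 - t * y1 + thi3 th + 2 * y1 * y2)
    (H_NY th t 0 y1 x2 y2)); first by ring.
  by move=> z; rewrite /H_NY /H_IV; ring.
have -> : derive1 (fun y => H_NY th t x1 y1 x2 y) y2 =
   2 * y2 * x2 - x2 ^+ 2 - t * x2 + (thi1 th - thi2 th - thi3 th - 1)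
   + 2 * y1 * x1.
  rewrite (quad _ x2
    (- x2 ^+ 2 - t * x2 + (thi1 th - thi2 th - thi3 th - 1) + 2 * y1 * x1)
    (H_NY th t x1 y1 x2 0)); first by ring.
  by move=> z; rewrite /H_NY /H_IV; ring.
have -> : derive1 (fun y => H_NY th t x1 y1 y y2) x2 =
   y2 ^+ 2 - 2 * y2 * x2 - t * y2 + (th01 th + thi2 th).
  rewrite (quad _ (- y2) (y2 ^+ 2 - t * y2 + (th01 th + thi2 th))
    (H_NY th t x1 y1 0 y2)); first by ring.
  by move=> z; rewrite /H_NY /H_IV; ring.
by [].
Qed.

Section CoefficientDerivatives.
Context {C : numClosedFieldType}.
Variables (th : theta C) (q1 p1 q2 p2 u v : C -> C) (t : C).
Variables (dq1 dp1 dq2 dp2 du dv : C).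
Hypotheses (hq1 : is_derive t 1 q1 dq1) (hp1 : is_derive t 1 p1 dp1)
  (hq2 : is_derive t 1 q2 dq2) (hp2 : is_derive t 1 p2 dp2)
  (hu : is_derive t 1 u du) (hv : is_derive t 1 v dv).

Let dcst (k : C) := @is_derive_cst _ _ C^o k t 1.
Let did := @is_derive_id _ C^o t 1.

Lemma is_derive_coef_a :
  is_derive t 1 (fun s => coef_a th s (q1 s) (p1 s) (q2 s) (p2 s))
    (dcoef_a t (p1 t) (q2 t) (p2 t) dp1 dq2 dp2).
Proof.
apply: (is_derive_eq (is_derive_add (is_derive_add (is_derive_add
  (is_derive_mul hp2 (is_derive_sub (is_derive_sub hp2 hq2) did))
  (is_derive_mul hp1 hp2)) (dcst _)) (dcst _))).
by rewrite /dcoef_a; ring.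
Qed.

Lemma is_derive_coef_b :
  is_derive t 1 (fun s => coef_b th s (q1 s) (p1 s) (q2 s) (p2 s))
    (dcoef_b t (q1 t) (p1 t) (p2 t) dq1 dp1 dp2).
Proof.
apply: (is_derive_eq (is_derive_add (is_derive_add
  (is_derive_mul hp1 (is_derive_sub (is_derive_sub hp1 hq1) did))
  (is_derive_mul hp1 hp2)) (dcst _))).
by rewrite /dcoef_b; ring.
Qed.

Lemma is_derive_coef_c :
  is_derive t 1 (fun s => coef_c th s (q1 s) (p1 s) (q2 s) (p2 s))
    (dcoef_c (q1 t) (p1 t) (q2 t) dq1 dp1 dq2).
Proof.
apply: (is_derive_eq (is_derive_add
  (is_derive_mul hp1 (is_derive_sub hq2 hq1)) (dcst _))).
by rewrite /dcoef_c; ring.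
Qed.

Lemma is_derive_Ahat_m1 :
  is_derive t 1 (fun s => Ahat_m1 s (q1 s) (p1 s) (q2 s) (p2 s))
    (dAhat_m1 dq1 dp1 dq2 dp2).
Proof.
exact: is_derive_mx3 (is_derive_sub (is_derive_add hp1 hp2) did) hq2 hq1
  (is_deriveN hp2) (is_deriveN hp2) (is_deriveN hp2)
  (is_deriveN hp1) (is_deriveN hp1) (is_deriveN hp1).
Qed.

Lemma is_derive_Ahat_0 :
  is_derive t 1 (fun s => Ahat_0 th s (q1 s) (p1 s) (q2 s) (p2 s))
    (dAhat_0 t (q1 t) (p1 t) (q2 t) (p2 t) dq1 dp1 dq2 dp2).
Proof.
exact: is_derive_mx3 (dcst _) (dcst _) (dcst _)
  (is_deriveN is_derive_coef_a) (dcst _) (dcst _)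
  (is_deriveN is_derive_coef_b) (is_deriveN is_derive_coef_c) (dcst _).
Qed.

(** The derivatives of the entries below the diagonal are left unspecified:
the part of (dG/dt) G^-1 that they determine is recovered from
[residue_eq]. *)
Lemma is_derive_Gmx : exists dg21 dg31 dg32,
  is_derive t 1 (fun s => Gmx th s (q1 s) (p1 s) (q2 s) (p2 s) (u s) (v s))
    (mx3 [:: [:: 0; 0; 0]; [:: dg21; du; 0]; [:: dg31; dg32; dv]]).
Proof.
have GE := funext (fun s =>
  Gmx_explicit th s (q1 s) (p1 s) (q2 s) (p2 s) (u s) (v s)).
have [da [db dc]] := (is_derive_coef_a, (is_derive_coef_b, is_derive_coef_c)).
do 3 eexists; rewrite GE.
exact: is_derive_mx3 (dcst _) (dcst _) (dcst _)
  (is_derive_mul da (dcst _)) hu (dcst _)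
  (is_derive_mul (dcst _)
    (is_derive_add db (is_derive_mul (is_derive_mul da dc) (dcst _))))
  (is_derive_mul (is_derive_mul dc (dcst _)) hu) hv.
Qed.

End CoefficientDerivatives.

(** * Compatibility and the Hamiltonian system *)

Theorem mainTheorem7 (R : realType) (th : theta (Cplx R))
  (hsum : th01 th + th02 th + thi1 th + thi2 th + thi3 th = 0)
  (h01 : th01 th != 0)
  (h12 : thi1 th != thi2 th) (h13 : thi1 th != thi3 th)
  (h23 : thi2 th != thi3 th)
  (D : set (Cplx R)) (hD : complex_domain D)
  (q1 p1 q2 p2 u v : Cplx R -> Cplx R)
  (hq1 : holomorphic_on D q1) (hp1 : holomorphic_on D p1)
  (hq2 : holomorphic_on D q2) (hp2 : holomorphic_on D p2)
  (hu : holomorphic_on D u) (hv : holomorphic_on D v)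
  (hu0 : forall t, D t -> u t != 0) (hv0 : forall t, D t -> v t != 0) :
  compatible D (Amx th q1 p1 q2 p2 u v) (Bmx th q1 p1 q2 p2 u v) <->
  hamiltonian_system D (H_NY th) q1 p1 q2 p2 /\
  gauge_equations D q1 p1 q2 p2 u v.
Proof.
have pointwise t : D t ->
  (forall x, x != 0 ->
    derive1 (fun s => Amx th q1 p1 q2 p2 u v x s) t
      - derive1 (fun y => Bmx th q1 p1 q2 p2 u v y t) x
      + commutator (Amx th q1 p1 q2 p2 u v x t) (Bmx th q1 p1 q2 p2 u v x t)
    = 0) <->
  NY_equations th t (q1 t) (p1 t) (q2 t) (p2 t)
    (derive1 q1 t) (derive1 p1 t) (derive1 q2 t) (derive1 p2 t) /\
  (u t)^-1 * derive1 u t = - p1 t - 2 * p2 t + q2 t + t /\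
  (v t)^-1 * derive1 v t = q1 t - 2 * p1 t - 2 * p2 t + t.
  move=> Dt.
  have dq1 := is_derive_derive1 (hq1 t Dt).
  have dp1 := is_derive_derive1 (hp1 t Dt).
  have dq2 := is_derive_derive1 (hq2 t Dt).
  have dp2 := is_derive_derive1 (hp2 t Dt).
  have du := is_derive_derive1 (hu t Dt).
  have dv := is_derive_derive1 (hv t Dt).
  have [dg21 [dg31 [dg32 dG]]] := is_derive_Gmx th dq1 dp1 dq2 dp2 du dv.
  have Gt := Gmx_unit th t (q1 t) (p1 t) (q2 t) (p2 t) (hu0 t Dt) (hv0 t Dt).
  have dA1 := is_derive_Ahat_m1 dq1 dp1 dq2 dp2.
  have dA0 := is_derive_Ahat_0 th dq1 dp1 dq2 dp2.
  have dN := is_derive_cst (Ahat_m2 (Cplx R)) t 1.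
  have residue := isospectral_flow dG dA0 Gt (fun s =>
    Ahat_0_eigen s (q1 s) (p1 s) (q2 s) (p2 s) (u s) (v s) h12 h13 h23).
  rewrite (compatibleP dG Gt dN dA1 dA0 residue).
  move: residue; set L := _ *m invmx _.
  have LG := mulmxKV Gt (mx3 [:: [:: 0; 0; 0]; [:: dg21; derive1 u t; 0];
                                 [:: dg31; dg32; derive1 v t]]).
  rewrite -/L Gmx_explicit in LG.
  have [l21 [l31 [l32 ->]]] := triangular_velocity (hu0 t Dt) (hv0 t Dt) LG.
  move=> residue; rewrite add0r.
  exact: pole_equations_NY h01 h12 h13 h23 residue.
split=> [H|[H1 H2] t Dt].
  have H' t Dt := (pointwise t Dt).1 (H t Dt).
  by split=> t Dt; have [HH HG] := H' t Dt; [apply/hamiltonian_NY|].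
by apply: (pointwise t Dt).2; split;
  [apply/hamiltonian_NY; exact: H1|exact: H2].
Qed.
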